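(* Let $0<q<1$, $p=-q$, let $\epsilon_1,\epsilon_2,\epsilon_3\in\{1,-1\}$, $\mu_1,\mu_2,\mu_3>0$, and let $N\geq 0$ be an integer. Put $\epsilon_N=(-1)^N\epsilon_1\epsilon_2\epsilon_3$, $\mu_N=N+\mu_1+\mu_2+\mu_3+1$ (in $\epsilon_N,\mu_N$ the subscript $N$ is only a label referring to these two quantities), $\tau_i=-\epsilon_i[\mu_i]_q$ for $i=1,2,3$, $\tau=-\epsilon_N[\mu_N]_q$, and $$\iota_k=(q^{1/2}+q^{-1/2})(\tau\tau_k+\tau_i\tau_j)\quad\text{for } (ijk) \text{ an even permutation of } \{1,2,3\}.$$ Let $$a=\epsilon_2\epsilon_3q^{\mu_2+\mu_3+1/2},\quad b=-\epsilon_1\epsilon_Nq^{\mu_1-\mu_N+1/2},\quad c=-\epsilon_1\epsilon_Nq^{\mu_1+\mu_N+1/2},\quad d=\epsilon_2\epsilon_3q^{\mu_2-\mu_3+1/2},$$ $$A_n=-\frac{(1+abp^n)(1-acp^n)(1-adp^n)(1-abcdp^{n-1})}{a(1-abcdp^{2n-1})(1-abcdp^{2n})},$$ $$C_n=\frac{a(1-p^n)(1-bcp^{n-1})(1-bdp^{n-1})(1+cdp^{n-1})}{(1-abcdp^{2n-2})(1-abcdp^{2n-1})},$$ and $$\lambda_n=(-1)^n\epsilon_1\epsilon_2[n+\mu_1+\mu_2+\tfrac12]_q,\quad U_n=\frac{\sqrt{A_{n-1}C_n}}{q-q^{-1}},\quad V_n=\frac{a-a^{-1}-A_n-C_n}{q-q^{-1}},$$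 with the convention $U_0=U_{N+1}=0$. On the $(N+1)$-dimensional vector space with basis $|N;n\rangle$, $n=0,1,\ldots,N$, define operators $I_1,I_3$ by $$I_3|N;n\rangle=\lambda_n|N;n\rangle,\qquad I_1|N;n\rangle=U_{n+1}|N;n+1\rangle+V_n|N;n\rangle+U_n|N;n-1\rangle.$$ Then $I_1$ and $I_3$ satisfy $$I_1^2I_3+(q+q^{-1})I_1I_3I_1+I_3I_1^2=I_3+(q^{1/2}+q^{-1/2})\iota_2I_1+\iota_3,$$ $$I_3^2I_1+(q+q^{-1})I_3I_1I_3+I_1I_3^2=I_1+(q^{1/2}+q^{-1/2})\iota_2I_3+\iota_1.$$ Moreover, with $I_2=q^{1/2}I_3I_1+q^{-1/2}I_1I_3-\iota_2$, the operator $$C=(q^{-1/2}-q^{3/2})I_1I_2I_3+qI_1^2+q^{-1}I_2^2+qI_3^2-(1-q)\iota_1I_1-(1-q^{-1})\iota_2I_2-(1-q)\iota_3I_3$$ acts as the scalar $$-(q-q^{-1})^2\tau_1\tau_2\tau_3\tau+\tau_1^2+\tau_2^2+\tau_3^2+\tau^2-\frac{q}{(1+q)^2},$$ and $U_n\neq0$ for $1\leq n\leq N$, so the representation is irreducible.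
   Context: $[x]_q=\frac{q^x-q^{-x}}{q-q^{-1}}$. Scalars added to operators are understood as multiples of the identity. Irreducible means that no proper nonzero subspace is stable under both $I_1$ and $I_3$. *)

(* Defs.v *)
From HB Require Import structures.
From mathcomp Require Import all_boot all_order all_algebra.
From mathcomp Require Import reals exp.

Set Implicit Arguments.
Unset Strict Implicit.
Unset Printing Implicit Defensive.

Import Order.TTheory GRing.Theory Num.Theory.
Local Open Scope ring_scope.

(* The q-number [x]_q, for a real number x. *)
Definition qnum (R : realType) (q x : R) : R :=
  (q `^ x - q `^ (- x)) / (q - q^-1).

Definition irreducible_pair (F : fieldType) (V : vectType F)
    (X Y : 'End(V)) : Prop :=
  forall W : {vspace V},
    (X @: W <= W)%VS -> (Y @: W <= W)%VS -> W = 0%VS \/ W = fullv.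

(* Main.v *)
Require Import Defs.
From HB Require Import structures.
From mathcomp Require Import all_boot all_order all_algebra.
From mathcomp Require Import reals exp ring lra.

Set Implicit Arguments.
Unset Strict Implicit.
Unset Printing Implicit Defensive.

Import Order.TTheory GRing.Theory Num.Theory.
Local Open Scope ring_scope.

(**
Put [r = q^(1/2)], [X_i = - eps_i q^mu_i], [W = - eps_N q^mu_N] and
[t_n = r p^n X1 X2]. All signs are absorbed: with [tau X = (X - 1/X)/(q - 1/q)]
one has [tau_i = tau X_i], [tau = tau W], [lambda_n = tau t_n],
[t_(n+1) = - q t_n], and [a, b, c, d] are [r X2 X3, - r X1/W, - r X1 W, r X2/X3].
In terms of [t = t_n], [V_n] is the solution of the diagonal part
[((q^(1/2) + q^(-1/2))^2 lambda_n^2 - 1) V_n = (q^(1/2) + q^(-1/2)) iota_2 lambda_n + iota_1]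
of the second relation, and [U_n^2] is a product of two quadratics in
[t/r + r/t] with coefficients in the [tau]s. [I2] is tridiagonal as well, with
off-diagonal coefficients [- r t_n U_(n+1)] and [(r/t_n) U_n], so both relations and
the Casimir identity reduce, coordinate by coordinate, to rational identities
in [r, t, tau_1, tau_2, tau_3, tau].

The factorisation of [A_(n-1) C_n] together with [W = - p^(N+1) X1 X2 X3] gives
[A_(-1) C_0 = A_N C_(N+1) = 0] and [A_(n-1) C_n > 0] in between. Irreducibility follows
since the [lambda_n] are distinct and no [U_n], [1 <= n <= N], vanishes.
*)

(** * Rational identities *)

(** Serves the side conditions of [field]: each denominator, expanded in [r], is matched by [ring]
    with an expression built from factors known to be nonzero. *)
Lemma neq0_of_eq (R : nzRingType) (x y : R) : x = y -> y != 0 -> x != 0.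
Proof. by move->. Qed.

Section ScalarIdentities.
Variables (R : realFieldType) (r T1 T2 T3 T : R).

Let q := r ^+ 2.
Let k := q - q^-1.
Let s := r + r^-1.
Let iota1 := s * (T * T1 + T2 * T3).
Let iota2 := s * (T * T2 + T3 * T1).
Let iota3 := s * (T * T3 + T1 * T2).

Definition awlam t := (t - t^-1) / k.

(* [s ^+ 2 * awlam t ^+ 2 - 1 = (t^2 - q)(q t^2 - 1) / ((1 - q)^2 t^2)]. *)
Definition awV t := (s * iota2 * awlam t + iota1) * ((1 - q) ^+ 2 * t ^+ 2)
   / ((t ^+ 2 - q) * (q * t ^+ 2 - 1)).

(* For [Ti = (X - 1/X)/k], [Tj = (Y - 1/Y)/k] and [g = u + 1/u] this is
   [(g - X Y - 1/(X Y)) (g + X/Y + Y/X)]. *)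
Definition awB Ti Tj (g : R) : R :=
  g ^+ 2 - 4 - k ^+ 2 * (Ti ^+ 2 + Tj ^+ 2 + g * Ti * Tj).

Definition awU2 t := let g := t / r + r / t in
  - (awB T1 T2 g * awB T3 T g * q ^+ 2 * t ^+ 4) /
    (k ^+ 2 * (t ^+ 2 - q) ^+ 2 * ((t ^+ 2 + 1) * (t ^+ 2 + q ^+ 2))).

Hypotheses (r_gt0 : 0 < r) (r_lt1 : r < 1).

Let r_neq0 : r != 0. Proof. by rewrite gt_eqF. Qed.
Let q_gt0 : 0 < q. Proof. by rewrite exprn_gt0. Qed.
Let q_lt1 : q < 1. Proof. by rewrite expr_lt1 // ltW. Qed.
Let qq_neq1 : q ^+ 2 - 1 != 0.
Proof. by rewrite subr_eq0 lt_eqF // expr_lt1 // ltW. Qed.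

Variable t : R.
Hypotheses (t_neq0 : t != 0) (t_ltq : t ^+ 2 < q).

Let t2_gt0 : 0 < t ^+ 2. Proof. by rewrite exprn_even_gt0. Qed.
Let tq_neq0 : t ^+ 2 - q != 0. Proof. by rewrite subr_eq0 lt_eqF. Qed.
Let t2_lt1 : t ^+ 2 < 1. Proof. exact: lt_trans t_ltq q_lt1. Qed.
(** At [t] and at the shifted point [- q * t], the denominators that positivity does not settle
    vanish only for [t^2 = q], [q t^2 = 1] or [q^3 t^2 = 1]; the bound [t^2 < q < 1] avoids all
    three. *)
Let qnt_neq0 n : q ^+ n * t ^+ 2 - 1 != 0.
Proof.
rewrite subr_eq0 lt_eqF // (le_lt_trans _ t2_lt1) // ler_piMl ?(ltW t2_gt0) //.
by rewrite exprn_ile1 // ltW.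
Qed.
Let qt_neq0 : q * t ^+ 2 - 1 != 0. Proof. exact: (qnt_neq0 1). Qed.
Let qqqt_neq0 : q ^+ 3 * t ^+ 2 - 1 != 0. Proof. exact: (qnt_neq0 3). Qed.
Let t2D1_neq0 : t ^+ 2 + 1 != 0. Proof. by rewrite gt_eqF // addr_gt0. Qed.
Let t2Dqq_neq0 : t ^+ 2 + q ^+ 2 != 0.
Proof. by rewrite gt_eqF // addr_gt0 // exprn_gt0. Qed.
Let qqt2D1_neq0 : q ^+ 2 * t ^+ 2 + 1 != 0.
Proof. by rewrite gt_eqF // addr_gt0 // mulr_gt0 // exprn_gt0. Qed.

Ltac sidec e := apply (@neq0_of_eq _ _ e); [by rewrite /q; ring | ].
Ltac side :=
  first [ assumption
   | sidec (q ^+ 2 - 1) | sidec (t ^+ 2 - q) | sidec (q * t ^+ 2 - 1)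
   | sidec (q ^+ 3 * t ^+ 2 - 1) | sidec (t ^+ 2 + 1) | sidec (t ^+ 2 + q ^+ 2)
   | sidec (q ^+ 2 * t ^+ 2 + 1)
   | sidec (q * (q * t ^+ 2 - 1)) | sidec (q ^+ 2 * (t ^+ 2 + 1))
   | sidec (q ^+ 2 * (q ^+ 2 * t ^+ 2 + 1))
   | sidec (- q * t) ];
  rewrite ?mulf_neq0 ?expf_neq0 ?oppr_eq0 //.

Ltac aw := rewrite /awU2 /awV /awB /awlam /iota1 /iota2 /iota3 /s /k /q; field;
  repeat (apply/andP; split); side.

(** The ratio [- q] between consecutive [t_n] is what makes the off-diagonal part of the second
    relation cancel. *)
Lemma awlam_quad : awlam (- q * t) ^+ 2 + (q + q^-1) * awlam (- q * t) * awlam t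
  + awlam t ^+ 2 = 1.
Proof. aw. Qed.

(** [- q] and [- 1/q] are the roots of [x^2 + (q + 1/q) x + 1], and [awlam] at [(- q)^n t] is a
    combination of their n-th powers. This removes the two-step terms of the first relation. *)
Lemma awlam_lin : awlam t + (q + q^-1) * awlam (- q * t) + awlam (q ^+ 2 * t) = 0.
Proof. aw. Qed.

Lemma awlam_twist_up : r * awlam (- q * t) + r^-1 * awlam t = - r * t.
Proof. aw. Qed.

Lemma awlam_twist_down : r * awlam (- t / q) + r^-1 * awlam t = r / t.
Proof. aw. Qed.

Lemma awlam_scaled : (r^-1 - r ^+ 3) * awlam t = - r * (t - t^-1).
Proof. aw. Qed.

Lemma awV_diag : s ^+ 2 * awlam t ^+ 2 * awV t = awV t + s * iota2 * awlam t + iota1.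
Proof. aw. Qed.

Lemma awV_offdiag :
  (awV t + awV (- q * t)) * (awlam t + awlam (- q * t))
  + (q + q^-1) * (awlam t * awV t + awlam (- q * t) * awV (- q * t)) = s * iota2.
Proof. aw. Qed.

(** Diagonal of the first relation: [awU2] at [- q * t] and at [t] stands for [U_(n+1)^2] and
    [U_n^2]. *)
Lemma awU2_diag :
 awU2 (- q * t) * (2 * awlam t + (q + q^-1) * awlam (- q * t))
 + awU2 t * (2 * awlam t + (q + q^-1) * awlam (- t / q)) + (awV t) ^+ 2 * s ^+ 2 * awlam t
 = awlam t + s * iota2 * awV t + iota3.
Proof. aw. Qed.

(** Diagonal entry of [I2]. The identities that follow are the one-step and diagonal coefficients of
    the Casimir operator. *)
Let beta t := s * awlam t * awV t - iota2.

Lemma awcasimir_up : q * t ^+ 2 * awV (- q * t) + q * awV t - r * (t - t^-1) * beta t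
   - t / r * (beta t + beta (- q * t)) - (1 - q) * iota1 + (1 - q^-1) * iota2 * r * t = 0.
Proof. rewrite /beta; aw. Qed.

(** Lowering factor [r / t_(n+1)] of [I2] at [t_(n+1) = - q t], simplified by [q = r^2]. *)
Let gam := - (r * t)^-1.

Lemma awcasimir_down : r * (q * t - (q * t)^-1) * (awV t * gam + beta (- q * t))
   + q * (awV t + awV (- q * t)) + q^-1 * gam * (beta t + beta (- q * t))
   - (1 - q) * iota1 - (1 - q^-1) * iota2 * gam = 0.
Proof. rewrite /gam /beta; aw. Qed.

Lemma awcasimir_diag : awU2 (- q * t) * (q * t ^+ 2 + q^-1) + awU2 t * (q / t ^+ 2 + q^-1)
  - r * (t - t^-1) * awV t * beta t + q * awV t ^+ 2 + q^-1 * beta t ^+ 2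
  + q * awlam t ^+ 2 - (1 - q) * iota1 * awV t - (1 - q^-1) * iota2 * beta t
  - (1 - q) * iota3 * awlam t =
   - (q - q^-1) ^+ 2 * T1 * T2 * T3 * T
               + T1 ^+ 2 + T2 ^+ 2 + T3 ^+ 2 + T ^+ 2
               - q / (1 + q) ^+ 2.
Proof.
rewrite /beta; have q1 : 1 + q != 0 by rewrite gt_eqF // addr_gt0.
aw. Qed.
End ScalarIdentities.

(** * Askey-Wilson coefficients as functions of [t] *)

Definition awtau (R : realFieldType) (r X : R) := (X - X^-1) / (r ^+ 2 - r ^- 2).

Section Coefficients.
Variables (R : realFieldType) (r X1 X2 X3 W : R).
Let q := r ^+ 2.
Let k := q - q^-1.
Let tau := awtau r.

(** [A_n] with [n] eliminated: for [t = t_n] one has [a b c d p^(2n) = q t^2],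
    [a b p^n = - r t X3 / W], and so on. The same holds for [awC]. *)
Definition awA t := - ((1 - r * t * X3 / W) * (1 + r * t * X3 * W)
  * (1 - r * t * X2 / X1) * (1 + r * t * X1 * X2))
  / (r * X2 * X3 * (1 + t ^+ 2) * (1 - q * t ^+ 2)).

Definition awC t := r * X2 * X3 * (1 - t / (r * X1 * X2)) * (1 + t * X1 / (r * X2))
  * (1 - t / (r * W * X3)) * (1 + t * W / (r * X3))
  / ((1 - t ^+ 2 / q) * (1 + t ^+ 2)).

Hypotheses (r_neq0 : r != 0) (X1_neq0 : X1 != 0) (X2_neq0 : X2 != 0) (X3_neq0 : X3 != 0)
  (W_neq0 : W != 0).
Variable t : R.
Hypotheses (q1 : q ^+ 2 - 1 != 0) (t1 : t ^+ 2 - q != 0) (t2 : q * t ^+ 2 - 1 != 0)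
  (t0 : t != 0).
Let t3 : t ^+ 2 + 1 != 0. Proof. by rewrite gt_eqF // ltr_wpDl // sqr_ge0. Qed.
Let t4 : t ^+ 2 + q ^+ 2 != 0.
Proof. by rewrite gt_eqF // ltr_wpDl ?sqr_ge0 // exprn_even_gt0 //= expf_neq0. Qed.
Ltac sidec e := apply (@neq0_of_eq _ _ e); [by rewrite /q; ring | ].
Ltac side :=
  first [ assumption
   | sidec (q ^+ 2 - 1) | sidec (t ^+ 2 - q) | sidec (q * t ^+ 2 - 1)
   | sidec (t ^+ 2 + 1) | sidec (t ^+ 2 + q ^+ 2)
   | sidec (- (q * t ^+ 2 - 1)) | sidec (- (t ^+ 2 - q)) ];
  rewrite ?mulf_neq0 ?expf_neq0 ?oppr_eq0 //.

Lemma awV_AC : (r * X2 * X3 - (r * X2 * X3)^-1 - awA t - awC t) / k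
  = awV r (tau X1) (tau X2) (tau X3) (tau W) t.
Proof.
rewrite /awA /awC /awV /awlam /tau /awtau /k /q.
by field; repeat (apply/andP; split); side.
Qed.

(** With [u = t / r] and [g = u + 1/u], the eight linear factors pair up as
    [(1 - u z) (1 - u / z) = u (g - z - 1/z)] for [z] equal to [X1 X2], [- X1 / X2], [W X3],
    [- W / X3]; two pairs make up each [awB]. The factor [1 - t^2 / q] occurs in both denominators,
    hence the square. *)
Lemma awU2_AC : awA (- t / q) * awC t / k ^+ 2
  = awU2 r (tau X1) (tau X2) (tau X3) (tau W) t.
Proof.
rewrite /awA /awC /awU2 /awB /tau /awtau /k /q.
by field; repeat (apply/andP; split); side.
Qed.
End Coefficients.

(** * Tridiagonal operators *)

Lemma eq_coord_basis (F : fieldType) (E : vectType F) (m : nat) (e : m.-tuple E)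
    (x y : E) :
  basis_of fullv e -> (forall i, coord e i x = coord e i y) -> x = y.
Proof.
move=> he h; rewrite (coord_basis he (memvf x)) (coord_basis he (memvf y)).
by apply: eq_bigr => i _; rewrite h.
Qed.

Section TridiagonalAction.
Variables (R F : fieldType) (f : {rmorphism R -> F}) (E : vectType F).
Variables (m : nat) (e : m.-tuple E) (he : basis_of fullv e).
Variables (v : int -> E) (X Z : 'End(E)) (U V L : int -> R).
Hypothesis ZvE : forall n, Z (v n) = f (L n) *: v n.
Hypothesis XvE : forall n,
  X (v n) = f (U (n + 1)) *: v (n + 1) + f (V n) *: v n + f (U n) *: v (n - 1).

Let ends (Y : 'End(E)) : (forall x y, Y (x + y) = Y x + Y y) *
  (forall a x, Y (a *: x) = a *: Y x) * (forall x, Y (- x) = - Y x).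
Proof. by do 2?split => *; rewrite ?linearD ?linearZ ?linearN. Qed.
Let lfunE := (add_lfunE, opp_lfunE, scale_lfunE, comp_lfunE, id_lfunE).
Let actE := (XvE, ZvE, ends X, ends Z, addrK, subrK).
(** Words of degree two in tridiagonal operators reach two steps at most, so five vectors occur.
    Coordinates turn the vector identity into a scalar one, which [ring] splits along five vanishing
    coefficients. *)
Let combine5 (a b c d g : R) (x1 x2 x3 x4 x5 : F) :
  a = 0 -> b = 0 -> c = 0 -> d = 0 -> g = 0 ->
  f a * x1 + f b * x2 + f c * x3 + f d * x4 + f g * x5 = 0.
Proof. by do 5![move->]; rewrite rmorph0 !mul0r !addr0. Qed.

Variables (K i1 i2 i3 : R).

(** The matrix of [X] is symmetric, so raising and lowering coefficients agree up to a shift of [j],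
    and each off-diagonal hypothesis is used twice. *)
Lemma tridiagonal_rel1 (n : int) :
    (forall j, U j * U (j + 1) * (L (j - 1) + K * L j + L (j + 1)) = 0) ->
    (forall j, U (j + 1) * ((V j + V (j + 1)) * (L j + L (j + 1))
         + K * (L j * V j + L (j + 1) * V (j + 1)) - i2) = 0) ->
    U (n + 1) ^+ 2 * (2 * L n + K * L (n + 1))
      + U n ^+ 2 * (2 * L n + K * L (n - 1)) + V n ^+ 2 * ((2 + K) * L n)
      - L n - i2 * V n - i3 = 0 ->
  ((X \o X \o Z)%VF + f K *: (X \o Z \o X)%VF + (Z \o X \o X)%VF) (v n)
  = (Z + f i2 *: X + f i3 *: \1%VF) (v n).
Proof.
move=> h2 h1 h0; apply: (eq_coord_basis he) => i; apply/eqP.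
rewrite -subr_eq0 !lfunE !actE !linearD !linearZ /=; apply/eqP.
have := h2 (n - 1); rewrite subrK => h2'.
have := h1 (n - 1); rewrite subrK => h1'.
move: h0 (h1 n) (h2 (n + 1)) h1' h2'; rewrite addrK.
move=> h0 hp hpp hm hmm; rewrite -(combine5
  (coord e i (v n)) (coord e i (v (n + 1))) (coord e i (v (n + 1 + 1)))
  (coord e i (v (n - 1))) (coord e i (v (n - 1 - 1))) h0 hp hpp hm hmm).
ring.
Qed.

Lemma tridiagonal_rel2 (n : int) :
    (forall j, U (j + 1) * (L (j + 1) ^+ 2 + K * L (j + 1) * L j + L j ^+ 2 - 1) = 0) ->
    V n * ((2 + K) * L n ^+ 2) - V n - i2 * L n - i1 = 0 ->
  ((Z \o Z \o X)%VF + f K *: (Z \o X \o Z)%VF + (X \o Z \o Z)%VF) (v n)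
  = (X + f i2 *: Z + f i1 *: \1%VF) (v n).
Proof.
move=> h1 h0; apply: (eq_coord_basis he) => i; apply/eqP.
rewrite -subr_eq0 !lfunE !actE !linearD !linearZ /=; apply/eqP.
have := h1 (n - 1); rewrite subrK => hm.
move: h0 (h1 n) hm => h0 hp hm.
(* The second relation is linear in [X], so nothing lies two steps away and two slots are filled
   with zeros. *)
rewrite -(combine5
  (coord e i (v n)) (coord e i (v (n + 1))) (coord e i (v (n - 1))) 0 0
   h0 hp hm (erefl 0) (erefl 0)).
ring.
Qed.

Lemma twisted_tridiagonal (r rV k : R) (n : int) :
  (f r *: (Z \o X)%VF + f rV *: (X \o Z)%VF - f k *: \1%VF) (v n) =
  f ((r * L (n + 1) + rV * L n) * U (n + 1)) *: v (n + 1)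
  + f ((r + rV) * L n * V n - k) *: v n
  + f ((r * L (n - 1) + rV * L n) * U n) *: v (n - 1).
Proof.
apply: (eq_coord_basis he) => i.
by rewrite !lfunE !actE !linearD !linearN !linearZ /=; ring.
Qed.

Variables (Y : 'End(E)) (al be ga : int -> R).
Hypothesis YvE : forall n, Y (v n) =
  f (al n * U (n + 1)) *: v (n + 1) + f (be n) *: v n + f (ga n * U n) *: v (n - 1).

(** The raising and lowering factors [al] and [ga] of [Y] differ, hence separate conditions in the
    two directions. [Z] acts first in the cubic term, so [L] is taken at the starting index. *)
Lemma tridiagonal_casimir (g q qV c1 c2 c3 cas : R) (n : int) :
    (forall j, U j * U (j + 1) * (g * L (j - 1) * al (j - 1) + q + qV * al (j - 1) * al j) = 0) ->
    (forall j, U j * U (j + 1) * (g * L (j + 1) * ga (j + 1) + q + qV * ga (j + 1) * ga j) = 0) ->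
    (forall j, U (j + 1) * (g * L j * (V (j + 1) * al j + be j) + q * (V j + V (j + 1))
          + qV * (al j * be j + be (j + 1) * al j) - c1 - c2 * al j) = 0) ->
    (forall j, U (j + 1) * (g * L (j + 1) * (V j * ga (j + 1) + be (j + 1))
          + q * (V j + V (j + 1))
          + qV * (ga (j + 1) * be (j + 1) + be j * ga (j + 1)) - c1 - c2 * ga (j + 1)) = 0) ->
    U (n + 1) ^+ 2 * (g * L n * al n + q + qV * al n * ga (n + 1))
     + U n ^+ 2 * (g * L n * ga n + q + qV * ga n * al (n - 1))
     + g * L n * V n * be n + q * V n ^+ 2 + qV * be n ^+ 2 + q * L n ^+ 2
     - c1 * V n - c2 * be n - c3 * L n - cas = 0 ->
  (f g *: (X \o Y \o Z)%VF
    + f q *: (X \o X)%VF + f qV *: (Y \o Y)%VF + f q *: (Z \o Z)%VF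
    - f c1 *: X - f c2 *: Y - f c3 *: Z) (v n) = (f cas *: \1%VF) (v n).
Proof.
move=> h2 h2' h1 h1' h0; apply: (eq_coord_basis he) => i; apply/eqP.
rewrite -subr_eq0 !lfunE !(YvE, ends Y, actE) !(linearD, linearN, linearZ) /=; apply/eqP.
have := h2' (n - 1); rewrite subrK => hmm.
have := h1' (n - 1); rewrite subrK => hm.
move: h0 (h1 n) (h2 (n + 1)) hm hmm; rewrite !addrK.
move=> h0 hp hpp hm hmm; rewrite -(combine5
  (coord e i (v n)) (coord e i (v (n + 1))) (coord e i (v (n + 1 + 1)))
  (coord e i (v (n - 1))) (coord e i (v (n - 1 - 1))) h0 hp hpp hm hmm).
ring.
Qed.
End TridiagonalAction.

Lemma eq_lfun_basis (F : fieldType) (E E' : vectType F) (m : nat) (e : m.-tuple E)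
    (f g : 'Hom(E, E')) :
  basis_of fullv e -> (forall i, (i < m)%N -> f e`_i = g e`_i) -> f = g.
Proof.
move=> he h; apply/lfunP => x; rewrite (coord_basis he (memvf x)) !linear_sum.
by apply: eq_bigr => i _; rewrite !linearZ /= h.
Qed.

(** * Irreducibility of a tridiagonal operator paired with a diagonal one *)

Section Irreducibility.
Variables (F : fieldType) (E : vectType F) (N : nat) (e : N.+1.-tuple E).
Variables (X Z : 'End(E)) (u w l : nat -> F).
Hypothesis he : basis_of fullv e.
Hypothesis ZeE : forall n, (n <= N)%N -> Z e`_n = l n *: e`_n.
Hypothesis XeE : forall n, (n <= N)%N ->
  X e`_n = u n.+1 *: e`_n.+1 + w n *: e`_n + u n *: e`_n.-1.
Hypothesis l_inj : {in [pred n | n <= N]%N &, injective l}.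
Hypothesis u_neq0 : forall n, (1 <= n <= N)%N -> u n != 0.

(* Applying the product of the [Z - l j], [j != i], isolates the component
   along [e`_i]. *)
Lemma component_mem_stable (W : {vspace E}) (x : E) (i : 'I_N.+1) :
  (Z @: W <= W)%VS -> x \in W -> coord e i x != 0 -> e`_i \in W.
Proof.
move=> ZW xW ci0.
have opE (s : seq 'I_N.+1) : foldr (fun (j : 'I_N.+1) y => Z y - l j *: y) x s =
    \sum_(k < N.+1) ((\prod_(j <- s) (l k - l j)) * coord e k x) *: e`_k.
  elim: s => [|j s IHs] /=.
    rewrite [LHS](coord_basis he (memvf x)).
    by apply: eq_bigr => k _; rewrite big_nil mul1r.
  rewrite IHs linear_sum scaler_sumr -sumrB; apply: eq_bigr => k _.
  rewrite linearZ /= ZeE -1?ltnS // !scalerA -scalerBl big_cons; congr (_ *: _).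
  ring.
have opW (s : seq 'I_N.+1) : foldr (fun (j : 'I_N.+1) y => Z y - l j *: y) x s \in W.
  elim: s => //= j s IHs; rewrite rpredB ?rpredZ //.
  by apply: (subvP ZW); rewrite memv_img.
have := opW [seq j <- enum 'I_N.+1 | j != i].
rewrite opE (bigD1 i) //= [X in _ + X]big1 => [|k ki]; last first.
  suff /eqP-> : \prod_(j <- [seq j <- enum 'I_N.+1 | j != i]) (l k - l j) == 0.
    by rewrite mul0r scale0r.
  rewrite prodf_seq_eq0; apply/hasP; exists k; last by rewrite subrr /=.
  by rewrite mem_filter ki mem_enum.
rewrite addr0 rpredZeq mulf_eq0 (negPf ci0) orbF => /orP[|//].
apply: contraTT => _.
rewrite prodf_seq_neq0; apply/allP => j; rewrite mem_filter => /andP[ji _].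
rewrite subr_eq0; apply: contra ji => /eqP /l_inj H.
by apply/eqP/esym/val_inj/H; rewrite inE -ltnS.
Qed.

(** A nonzero stable [W] contains some [e_i]. The image [X e_i] has a nonzero component along each
    neighbour of [e_i], which then lies in [W] too: descend to [e_0], then climb to [e_N]. *)
Lemma tridiagonal_irreducible : irreducible_pair X Z.
Proof.
move=> W XW ZW.
have free_e := basis_free he.
have step i j : (i <= N)%N -> (j <= N)%N -> e`_i \in W ->
    (i == j.+1) || (j == i.+1) -> e`_j \in W.
  move=> iN jN eiW ij.
  have XeW : X e`_i \in W by apply: (subvP XW); rewrite memv_img.
  have jN1 : (j < N.+1)%N by [].
  have iN1 : (i < N.+1)%N by [].
  apply: (component_mem_stable (i := Ordinal jN1) ZW XeW).
  rewrite XeE // !linearD !linearZ /=.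
  have cE k : (k <= N)%N -> coord e (Ordinal jN1) e`_k = (k == j)%:R.
    rewrite -ltnS => kN.
    by have /= -> := coord_free (Ordinal kN) (Ordinal jN1) free_e.
  rewrite (cE i) // (cE i.-1); last by rewrite (leq_trans (leq_pred _)).
  case/orP: ij => /eqP ij.
    rewrite ij /= eqxx mulr1 (gtn_eqF (ltnSn _)) mulr0 addr0.
    (* For [i = N] the raised vector is the default value 0 of the tuple. *)
    have [jN2|jN2] := ltnP j.+1 N.
      rewrite cE // (gtn_eqF (leqW (ltnSn _))) mulr0 add0r.
      by rewrite u_neq0 // -ij iN ij.
    rewrite [X in coord e _ X]nth_default ?size_tuple // linear0 mulr0 add0r.
    by rewrite u_neq0 // -ij iN ij.
  rewrite -ij cE // eqxx mulr1 ij (ltn_eqF (ltnSn _)) mulr0 addr0.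
  by rewrite (ltn_eqF (leq_ltn_trans (leq_pred _) (ltnSn _))) mulr0 addr0 u_neq0 // -ij jN ij.
have [->|W0] := eqVneq W 0%VS; [by left | right].
have [i eiW] : exists i : 'I_N.+1, e`_i \in W.
  have xW := memv_pick W; have x0 : vpick W != 0 by rewrite vpick0.
  have [i ci0|c0] := pickP (fun i => coord e i (vpick W) != 0).
    by exists i; apply: component_mem_stable ci0.
  case/eqP: x0; rewrite (coord_basis he (memvf (vpick W))) big1 // => i _.
  by move/negbFE/eqP: (c0 i) => ->; rewrite scale0r.
have down n : (n <= i)%N -> e`_(i - n) \in W.
  elim: n => [|n IHn] ni; first by rewrite subn0.
  apply: step (IHn (ltnW ni)) _; rewrite ?(leq_trans (leq_subr _ _)) -1?ltnS //.
  by rewrite -subSn // subSS eqxx.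
have all_e n : (n <= N)%N -> e`_n \in W.
  elim: n => [|n IHn] nN; first by rewrite -(subnn i) down.
  by apply: step (IHn (ltnW nN)) _ => //; rewrite ?eqxx ?orbT // ltnW.
apply/eqP; rewrite eqEsubv subvf -(span_basis he); apply/span_subvP => y.
by case/(nthP 0) => n; rewrite size_tuple ltnS => nN <-; apply: all_e.
Qed.
End Irreducibility.

(** * The representation attached to Askey-Wilson parameters *)

(** Here [P = p^n] and [M = p^(N+1-n)]. The factor [1 + t X3 / (r W) = - (1 - M) / M] cancels the
    leading sign of [awA]. What remains is [N / D]: the factors of [N] are [1 - y] or [1 + y] with
    [|y| < 1], and [D] is a product of positive terms, whatever the signs of the parameters. *)
Lemma awAC_gt0 (R : realFieldType) (r X1 X2 X3 P M : R)
    (t := r * P * X1 * X2) (W := - (P * M * X1 * X2 * X3)) :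
    0 < `|r| < 1 -> 0 < `|X1| < 1 -> 0 < `|X2| < 1 -> 0 < `|X3| < 1 ->
    0 < `|P| < 1 -> 0 < `|M| < 1 ->
  0 < awA r X1 X2 X3 W (- t / r ^+ 2) * awC r X1 X2 X3 W t.
Proof.
have absM (x y : R) : 0 < `|x| < 1 -> 0 < `|y| < 1 -> 0 < `|x * y| < 1.
  move=> /andP[x0 x1] /andP[y0 y1]; rewrite normrM mulr_gt0 //=.
  by rewrite mulr_ilt1 // ltW.
have neq0 (x : R) : 0 < `|x| < 1 -> x != 0 by rewrite normr_gt0 => /andP[].
have bnd (x : R) : 0 < `|x| < 1 -> (0 < 1 - x) * (0 < 1 + x).
  by case/andP => _; rewrite ltr_norml => /andP[? ?]; split; lra.
move=> hr h1 h2 h3 hP hM.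
have ht : 0 < `|t| < 1 by rewrite !absM.
pose N := (1 - P * (X1 * X2) ^+ 2) * (1 - P) * (1 + P * X1 ^+ 2) * (1 + P * X2 ^+ 2)
  * ((1 + M * X3 ^+ 2) * (1 - M) * (1 - P ^+ 2 * M * (X1 * X2) ^+ 2)
  * (1 + P ^+ 2 * M * (X1 * X2 * X3) ^+ 2)).
pose D := (M * X3 * (1 - (P * X1 * X2) ^+ 2)) ^+ 2 * (1 + (P * X1 * X2 / r) ^+ 2) * (1 + t ^+ 2).
have sq1 (x : R) : 0 < 1 + x ^+ 2 by rewrite ltr_pwDl // sqr_ge0.
have hPX : 0 < 1 - (P * X1 * X2) ^+ 2 by rewrite bnd // expr2 !absM.
have -> : awA r X1 X2 X3 W (- t / r ^+ 2) * awC r X1 X2 X3 W t = N / D.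
  rewrite /awA /awC /N /D /W /t; field.
  have r2D (x : R) : r ^+ 2 + x ^+ 2 != 0.
    by rewrite gt_eqF // ltr_pwDl ?sqr_ge0 // exprn_even_gt0 ?neq0.
  rewrite !(neq0 _ hr, neq0 _ h1, neq0 _ h2, neq0 _ h3, neq0 _ hP, neq0 _ hM).
  rewrite r2D (gt_eqF hPX) (gt_eqF (sq1 _)) /=.
  rewrite (_ : r ^+ 2 - _ = r ^+ 2 * (1 - (P * X1 * X2) ^+ 2)); last by ring.
  rewrite (_ : r ^+ 2 ^+ 2 + _ = r ^+ 2 * (r ^+ 2 + (P * X1 * X2) ^+ 2)); last by ring.
  by rewrite !mulf_neq0 ?r2D ?(expf_neq0 _ (neq0 _ hr)) ?(neq0 _ hr) ?(gt_eqF hPX).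
rewrite divr_gt0 //.
  by rewrite ?mulr_gt0 // bnd // ?expr2 !absM.
apply: mulr_gt0 => //; apply: mulr_gt0 => //.
by rewrite exprn_even_gt0 //= !mulf_neq0 ?(neq0 _ hM) ?(neq0 _ h3) ?(gt_eqF hPX).
Qed.

Section Representations.
Variables (R : realFieldType) (r X1 X2 X3 : R) (N : nat).
Let q := r ^+ 2.
Let W := - ((- q) ^+ N.+1 * X1 * X2 * X3).
Let k := q - q^-1.
Let tau := awtau r.
Let s := r + r^-1.
Let iota1 := s * (tau W * tau X1 + tau X2 * tau X3).
Let iota2 := s * (tau W * tau X2 + tau X3 * tau X1).
Let iota3 := s * (tau W * tau X3 + tau X1 * tau X2).
Let L t := awlam r t.
Let V t := awV r (tau X1) (tau X2) (tau X3) (tau W) t.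
Let U2 t := awU2 r (tau X1) (tau X2) (tau X3) (tau W) t.

Hypotheses (r_gt0 : 0 < r) (r_lt1 : r < 1).
Hypotheses (X1_bnd : 0 < `|X1| < 1) (X2_bnd : 0 < `|X2| < 1) (X3_bnd : 0 < `|X3| < 1).

Definition awt (n : int) := r * (- (r ^+ 2)) ^ n * X1 * X2.
Let t := awt.

Let r_neq0 : r != 0. Proof. by rewrite gt_eqF. Qed.
Let p_neq0 : - q != 0. Proof. by rewrite oppr_eq0 expf_neq0. Qed.
Let X_neq0 (x : R) : 0 < `|x| < 1 -> x != 0.
Proof. by rewrite normr_gt0 => /andP[]. Qed.
Let X1_neq0 := X_neq0 X1_bnd.
Let X2_neq0 := X_neq0 X2_bnd.
Let X3_neq0 := X_neq0 X3_bnd.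
Let W_neq0 : W != 0.
Proof. by rewrite oppr_eq0 !mulf_neq0 ?expf_neq0. Qed.

Lemma awtS n : t (n + 1) = - q * t n.
Proof. by rewrite /t /awt expfzDr // expr1z -/q; ring. Qed.

Lemma awt_pred n : t (n - 1) = - t n / q.
Proof.
have := awtS (n - 1); rewrite subrK => ->.
by rewrite !mulNr opprK mulrC mulKf // expf_neq0.
Qed.

Lemma awt_neq0 n : t n != 0.
Proof. by rewrite !mulf_neq0 ?expfz_neq0. Qed.

(** Makes the rational identities applicable at every [t_n]; [n] is natural so that
    [(q^2)^n <= 1]. *)
Lemma awt_lt (n : nat) : t n ^+ 2 < q.
Proof.
have lt1 (x : R) : 0 < `|x| < 1 -> x ^+ 2 < 1.
  by case/andP => _ x1; rewrite -real_normK ?num_real // expr_lt1.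
have q_lt1 : q ^+ 2 < 1 by rewrite /q -exprM expr_lt1 // ltW.
have -> : t n ^+ 2 = q * ((- q) ^+ (n * 2) * X1 ^+ 2 * X2 ^+ 2).
  by rewrite /t /awt -exprnP -/q exprM /q; ring.
rewrite gtr_pMr ?exprn_gt0 // mulnC exprM sqrrN.
apply: le_lt_trans (lt1 _ X2_bnd); rewrite ler_piMl ?sqr_ge0 //.
have qn : (q ^+ 2) ^+ n <= 1 by apply: exprn_ile1; [exact: sqr_ge0|exact: ltW].
have qn0 : 0 <= (q ^+ 2) ^+ n by apply: exprn_ge0; exact: sqr_ge0.
by apply: mulr_ile1; rewrite ?sqr_ge0 // ltW // lt1.
Qed.

Let tq_neq0 (n : nat) : t n ^+ 2 - q != 0.
Proof. by rewrite subr_eq0 lt_eqF // awt_lt. Qed.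
Let q_gt0 : 0 < q. Proof. by rewrite exprn_gt0. Qed.
Let q_lt1 : q < 1. Proof. by rewrite expr_lt1 // ltW. Qed.
Let qq_neq1 : q ^+ 2 - 1 != 0.
Proof. by rewrite subr_eq0 lt_eqF // expr_lt1 // ltW. Qed.
Let qt_neq0 (n : nat) : q * t n ^+ 2 - 1 != 0.
Proof.
rewrite subr_eq0 lt_eqF // mulr_ilt1 ?sqr_ge0 // ?(ltW q_gt0) //.
exact: lt_trans (awt_lt n) q_lt1.
Qed.

Let k_neq0 : k != 0.
Proof.
rewrite /k (_ : q - q^-1 = (q ^+ 2 - 1) / q); first by rewrite mulf_neq0 // invr_eq0 gt_eqF.
by rewrite mulrBl expr2 mulfK ?mul1r // gt_eqF.
Qed.

Lemma awV_t (n : nat) :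
  V (t n) = (r * X2 * X3 - (r * X2 * X3)^-1 - awA r X1 X2 X3 W (t n)
             - awC r X1 X2 X3 W (t n)) / k.
Proof. by rewrite /V -awV_AC ?awt_neq0. Qed.

Lemma awU2_t (n : nat) :
  U2 (t n) = awA r X1 X2 X3 W (t (n%:Z - 1)) * awC r X1 X2 X3 W (t n) / k ^+ 2.
Proof. by rewrite /U2 -awU2_AC ?awt_neq0 // awt_pred. Qed.

(** The factor [1 - p^n] of [C_n] vanishes at [n = 0]. *)
Lemma awU2_t0 : U2 (t 0) = 0.
Proof.
rewrite awU2_t /awC /t /awt expr0z mulr1 divff ?mulf_neq0 // subrr.
by rewrite !(mulr0, mul0r).
Qed.

(** Truncation: [r t_N X3 = W] by the choice of [W], which kills the first factor of [A_N]. *)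
Lemma awU2_tN : U2 (t N.+1) = 0.
Proof.
rewrite awU2_t -addn1 PoszD addrK /awA /t /awt -exprnP -/q.
rewrite (_ : r * (r * (- q) ^+ N * X1 * X2) * X3 = W); last first.
  by rewrite /W exprS /q; ring.
by rewrite divff // subrr !(mulr0, mul0r, oppr0).
Qed.

Lemma awAC_t_gt0 (n : nat) : (1 <= n <= N)%N ->
  0 < awA r X1 X2 X3 W (t (n%:Z - 1)) * awC r X1 X2 X3 W (t n).
Proof.
case/andP=> n1 nN; rewrite awt_pred.
have p_bnd m : (0 < m)%N -> 0 < `|(- q) ^+ m| < 1.
  move=> m0; rewrite normrX normrN gtr0_norm // exprn_gt0 //=.
  by rewrite exprn_ilt1 // ?ltW // -lt0n.
have -> : W = - ((- q) ^+ n * (- q) ^+ (N.+1 - n) * X1 * X2 * X3).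
  by rewrite -exprD subnKC // ltnW.
rewrite {1 2}/t /awt -exprnP; apply: awAC_gt0; rewrite ?p_bnd ?subn_gt0 //.
by rewrite gtr0_norm // r_gt0.
Qed.

(** [x - 1/x = y - 1/y] forces [x = y] or [x y = -1]. The second is excluded by [|t_n| < 1], and
    [|t_n|] is strictly decreasing in [n]. *)
Lemma awlam_t_inj : injective (fun n : nat => L (t n)).
Proof.
move=> n m; rewrite /L /awlam => /(mulIf _) H.
have {H} : t n - (t n)^-1 = t m - (t m)^-1.
  by apply: H; rewrite invr_eq0 -/q -/k.
move/eqP; rewrite -subr_eq0 (_ : _ - _ = (t n - t m) * (1 + (t n * t m)^-1)); last first.
  by field; rewrite !awt_neq0.
rewrite mulf_eq0 => /orP[|].
  rewrite subr_eq0 /t /awt => /eqP /(mulIf X2_neq0) /(mulIf X1_neq0) /(mulfI r_neq0).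
  rewrite -!exprnP => /(congr1 Num.norm); rewrite !normrX normrN gtr0_norm //.
  by apply: ieexprIn => //; rewrite lt_eqF.
rewrite addrC addr_eq0 => /eqP H; exfalso.
have {}H : t n * t m = - 1 by rewrite -[LHS]invrK H invrN invr1.
have t1 (j : nat) : t j ^+ 2 < 1 by apply: lt_trans (awt_lt j) q_lt1.
have := t1 n; have := t1 m; nra.
Qed.

(** * The relations and the Casimir operator on the representation space *)

Section Representation.
Variables (F : fieldType) (f : {rmorphism R -> F}) (E : vectType F).
Variables (e : N.+1.-tuple E) (I1 I3 : 'End(E)) (u : nat -> R).
Hypothesis he : basis_of fullv e.
Hypotheses (u0 : u 0 = 0) (uN : u N.+1 = 0).
Hypothesis u_sq : forall n : nat, (1 <= n <= N)%N -> u n ^+ 2 = U2 (t n).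
Hypothesis I3eE : forall n : nat, (n <= N)%N -> I3 e`_n = f (L (t n)) *: e`_n.
Hypothesis I1eE : forall n : nat, (n <= N)%N ->
  I1 e`_n = f (u n.+1) *: e`_n.+1 + f (V (t n)) *: e`_n + f (u n) *: e`_n.-1.

(* Extending everything to [int] makes the action uniform, without boundary
   cases: the out-of-range terms vanish because [v] or [Uz] does. *)
Let v (n : int) : E := if n is Posz m then e`_m else 0.
Let Uz (n : int) : R := if n is Posz m then u m else 0.
Let Vz (n : int) := V (t n).
Let Lz (n : int) := L (t n).

Let e_out n : (N < n)%N -> e`_n = 0.
Proof. by move=> Nn; rewrite nth_default // size_tuple. Qed.

Let I3vE n : I3 (v n) = f (Lz n) *: v n.
Proof.
case: n => n /=; last by rewrite linear0 scaler0.
by have [/I3eE //|/e_out->] := leqP n N; rewrite linear0 scaler0.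
Qed.

Let I1vE n : I1 (v n) = f (Uz (n + 1)) *: v (n + 1) + f (Vz n) *: v n + f (Uz n) *: v (n - 1).
Proof.
case: n => [n|[|n]]; last first.
- rewrite (_ : Negz n.+1 + 1 = Negz n); last first.
    by rewrite !NegzE -[n.+2]addn1 PoszD opprD subrK.
  by rewrite /= linear0 !scaler0 !addr0.
- by rewrite NegzE addNr /= u0 rmorph0 linear0 !scaler0 scale0r !addr0.
rewrite -PoszD addn1 /=; have [nN|Nn] := leqP n N.
  rewrite I1eE //; congr (_ + _ + _).
  by case: n {nN} => [|n] /=; rewrite ?u0 ?rmorph0 ?scale0r // subn1.
rewrite !e_out ?linear0 ?scaler0 ?add0r //; last exact: ltnW.
(* At index [N + 1] the lowering term reaches [e_N], with coefficient [u N.+1 = 0]; beyond that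
   every vector is 0. *)
case: n Nn => [//|n]; rewrite ltnS leq_eqVlt => /predU1P[<-|Nn].
  by rewrite uN rmorph0 scale0r.
by rewrite intS addrAC subrr add0r /= e_out ?scaler0.
Qed.

(* Every identity needed off the diagonal carries a factor [Uz j], which
   vanishes for [j <= 0]. *)
Let Uz_case j : Uz j = 0 \/ exists n : nat, j = n%:Z + 1.
Proof.
case: j => [[|n]|n]; [by left | right | by left].
by exists n; rewrite -addn1.
Qed.

Let u_sqN (n : nat) : (n <= N.+1)%N -> u n ^+ 2 = U2 (t n).
Proof.
case: n => [|n]; first by rewrite u0 expr0n awU2_t0.
rewrite ltnS leq_eqVlt => /predU1P[->|nN]; first by rewrite uN expr0n awU2_tN.
by rewrite u_sq.
Qed.

Let Uz_sqS (n : nat) : (n <= N)%N -> Uz (n%:Z + 1) ^+ 2 = U2 (- q * t n).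
Proof. by move=> nN; rewrite -awtS -PoszD addn1 /= u_sqN. Qed.
Let Uz_sq (n : nat) : (n <= N)%N -> Uz n%:Z ^+ 2 = U2 (t n).
Proof. by move=> nN; rewrite /= u_sqN // ltnW. Qed.

Let I2 : 'End(E) := f r *: (I3 \o I1)%VF + f r^-1 *: (I1 \o I3)%VF - f iota2 *: \1%VF.
Let be (n : int) := s * Lz n * Vz n - iota2.

Let I2vE n : I2 (v n) = f (- r * t n * Uz (n + 1)) *: v (n + 1) + f (be n) *: v n
  + f (r / t n * Uz n) *: v (n - 1).
Proof.
rewrite /I2 (twisted_tridiagonal he I3vE I1vE) /Lz /L awtS awt_pred.
by rewrite awlam_twist_up ?awlam_twist_down ?awt_neq0.
Qed.

Lemma aw_rel1 : (I1 \o I1 \o I3)%VF + f (q + q^-1) *: (I1 \o I3 \o I1)%VF + (I3 \o I1 \o I1)%VF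
  = I3 + f (s * iota2) *: I1 + f iota3 *: \1%VF.
Proof.
apply: (eq_lfun_basis he) => n nN; rewrite -[e`_n]/(v n).
apply: (tridiagonal_rel1 he I3vE I1vE).
- move=> j; have [->|[m ->]] := Uz_case j; first by rewrite !mul0r.
  by rewrite addrK /Lz /L !awtS mulrA mulrNN -expr2 awlam_lin ?awt_neq0 ?awt_lt // mulr0.
- move=> j; have [->|[m /addIr ->]] := Uz_case (j + 1); first by rewrite mul0r.
  by rewrite /Lz /L /Vz /V !awtS awV_offdiag ?awt_neq0 ?awt_lt // subrr mulr0.
rewrite Uz_sqS ?Uz_sq // /Lz /Vz awtS awt_pred.
have H : U2 (- q * t n) * (2 * L (t n) + (q + q^-1) * L (- q * t n))
    + U2 (t n) * (2 * L (t n) + (q + q^-1) * L (- t n / q)) + V (t n) ^+ 2 * s ^+ 2 * L (t n)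
    = L (t n) + s * iota2 * V (t n) + iota3.
  exact: awU2_diag (awt_neq0 n) (awt_lt n).
rewrite -!addrA -!opprD addrA; apply/eqP; rewrite !addrA subr_eq0 -H; apply/eqP.
(* The two sides differ only by [s^2 = 2 + q + 1/q]. *)
congr (_ + _); rewrite /s /q; field.
exact: r_neq0.
Qed.

Lemma aw_rel2 : (I3 \o I3 \o I1)%VF + f (q + q^-1) *: (I3 \o I1 \o I3)%VF + (I1 \o I3 \o I3)%VF
  = I1 + f (s * iota2) *: I3 + f iota1 *: \1%VF.
Proof.
apply: (eq_lfun_basis he) => n nN; rewrite -[e`_n]/(v n).
apply: (tridiagonal_rel2 he I3vE I1vE).
- move=> j; have [->|[m /addIr ->]] := Uz_case (j + 1); first by rewrite mul0r.
  by rewrite /Lz /L !awtS awlam_quad ?awt_neq0 ?awt_lt // subrr mulr0.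
have H : s ^+ 2 * L (t n) ^+ 2 * V (t n) = V (t n) + s * iota2 * L (t n) + iota1.
  exact: awV_diag (awt_neq0 n) (awt_lt n).
rewrite -!addrA -!opprD addrA; apply/eqP; rewrite /Lz /Vz !addrA subr_eq0 -H; apply/eqP.
rewrite /s /q; field.
exact: r_neq0.
Qed.

Lemma aw_casimir :
  f (r^-1 - r ^+ 3) *: (I1 \o I2 \o I3)%VF
    + f q *: (I1 \o I1)%VF + f q^-1 *: (I2 \o I2)%VF + f q *: (I3 \o I3)%VF
    - f ((1 - q) * iota1) *: I1 - f ((1 - q^-1) * iota2) *: I2
    - f ((1 - q) * iota3) *: I3 =
  f (- (q - q^-1) ^+ 2 * tau X1 * tau X2 * tau X3 * tau W
               + tau X1 ^+ 2 + tau X2 ^+ 2 + tau X3 ^+ 2 + tau W ^+ 2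
               - q / (1 + q) ^+ 2) *: \1%VF.
Proof.
apply: (eq_lfun_basis he) => n nN; rewrite -[e`_n]/(v n).
have gL j : (r^-1 - r ^+ 3) * Lz j = - r * (t j - (t j)^-1).
  by rewrite awlam_scaled ?awt_neq0.
have tn0 := awt_neq0.
have bE m : be (m + 1) = s * L (- q * t m) * V (- q * t m) - iota2.
  by rewrite /be /Lz /Vz awtS.
apply: (tridiagonal_casimir he I3vE I1vE I2vE).
(* For [t = t_(j-1)] the bracket is [q (t^2 - 1) + q - q t^2]; the lowering case is analogous. *)
- move=> j; have [->|[m ->]] := Uz_case j; first by rewrite !mul0r.
  rewrite gL addrK !awtS [X in _ * X](_ : _ = 0) ?mulr0 // /q; field.
  by rewrite tn0 r_neq0.
- move=> j; have [->|[m ->]] := Uz_case j; first by rewrite !mul0r.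
  rewrite gL !awtS [X in _ * X](_ : _ = 0) ?mulr0 // /q; field.
  by rewrite ?tn0 ?r_neq0 ?mulf_neq0 ?oppr_eq0 ?expf_neq0.
- move=> j; have [->|[m /addIr ->]] := Uz_case (j + 1); first by rewrite mul0r.
  rewrite gL bE [X in _ * X](_ : _ = 0) ?mulr0 //.
  have H : q * t m ^+ 2 * V (- q * t m) + q * V (t m) - r * (t m - (t m)^-1) * be m
      - t m / r * (be m + (s * L (- q * t m) * V (- q * t m) - iota2))
      - (1 - q) * iota1 + (1 - q^-1) * iota2 * r * t m = 0.
    exact: awcasimir_up (awt_neq0 m) (awt_lt m).
  rewrite -[RHS]H /Vz awtS /q; field.
  by rewrite tn0 r_neq0.
- move=> j; have [->|[m /addIr ->]] := Uz_case (j + 1); first by rewrite mul0r.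
  rewrite gL bE [X in _ * X](_ : _ = 0) ?mulr0 //.
  have H : r * (q * t m - (q * t m)^-1) *
      (V (t m) * - (r * t m)^-1 + (s * L (- q * t m) * V (- q * t m) - iota2))
      + q * (V (t m) + V (- q * t m))
      + q^-1 * - (r * t m)^-1 * (be m + (s * L (- q * t m) * V (- q * t m) - iota2))
      - (1 - q) * iota1 - (1 - q^-1) * iota2 * - (r * t m)^-1 = 0.
    exact: awcasimir_down (awt_neq0 m) (awt_lt m).
  rewrite -[RHS]H /Vz awtS /q; field.
  by rewrite ?tn0 ?r_neq0 ?mulf_neq0 ?oppr_eq0 ?expf_neq0.
rewrite Uz_sqS ?Uz_sq // gL !awtS awt_pred; apply/eqP; rewrite subr_eq0; apply/eqP.
have H : U2 (- q * t n) * (q * t n ^+ 2 + q^-1) + U2 (t n) * (q / t n ^+ 2 + q^-1)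
    - r * (t n - (t n)^-1) * V (t n) * be n + q * V (t n) ^+ 2 + q^-1 * be n ^+ 2
    + q * L (t n) ^+ 2 - (1 - q) * iota1 * V (t n) - (1 - q^-1) * iota2 * be n
    - (1 - q) * iota3 * L (t n) =
    - (q - q^-1) ^+ 2 * tau X1 * tau X2 * tau X3 * tau W
    + tau X1 ^+ 2 + tau X2 ^+ 2 + tau X3 ^+ 2 + tau W ^+ 2 - q / (1 + q) ^+ 2.
  exact: awcasimir_diag (awt_neq0 n) (awt_lt n).
rewrite -[RHS]H /Vz /Lz /q; field.
by rewrite ?tn0 ?r_neq0 ?mulf_neq0 ?oppr_eq0 ?expf_neq0.
Qed.

End Representation.
End Representations.

(** * Substituting the parameters *)

Section AskeyWilsonParameters.
Variables (R : realFieldType) (r X1 X2 X3 W : R).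
Hypotheses (r_neq0 : r != 0) (X1_neq0 : X1 != 0) (X2_neq0 : X2 != 0)
  (X3_neq0 : X3 != 0) (W_neq0 : W != 0).
Let q := r ^+ 2.
Let p := - q.
Let a := r * X2 * X3.
Let b := - (r * X1 / W).
Let c := - (r * X1 * W).
Let d := r * X2 / X3.

Let p_neq0 : p != 0. Proof. by rewrite oppr_eq0 expf_neq0. Qed.
Let pz_pred (n : int) : p ^ (n - 1) = - (p ^ n / q).
Proof. by rewrite expfzDr // exprN1 invrN mulrN. Qed.
Let pz2 (n : int) : p ^ (2 * n) = p ^ n * p ^ n.
Proof. by rewrite -expfzDr // mulr_natl. Qed.
Let pz2B1 (n : int) : p ^ (2 * n - 1) = p ^ n * p ^ (n - 1).
Proof. by rewrite -expfzDr // mulr_natl mulr2n addrA. Qed.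
Let pz2B2 (n : int) : p ^ (2 * n - 2) = p ^ (n - 1) * p ^ (n - 1).
Proof. by rewrite -expfzDr //; congr (_ ^ _); ring. Qed.

Lemma awA_awt (n : int) :
  - (((1 + a * b * p ^ n) * (1 - a * c * p ^ n) * (1 - a * d * p ^ n) *
        (1 - a * b * c * d * p ^ (n - 1))) /
       (a * (1 - a * b * c * d * p ^ (2 * n - 1)) *
        (1 - a * b * c * d * p ^ (2 * n)))) = awA r X1 X2 X3 W (awt r X1 X2 n).
Proof.
rewrite /awA /awt -/q -/p pz2 pz2B1 pz_pred -mulNr.
(* All powers of [p] are now expressed through [p^n], so the two sides can be compared factor by
   factor with [P] arbitrary. *)
move: (p ^ n) => P; rewrite /a /b /c /d /q.
congr (- (_ * _ * _ * _) / (_ * _ * _)); field;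
  by rewrite ?r_neq0 ?X1_neq0 ?X2_neq0 ?X3_neq0 ?W_neq0.
Qed.

Lemma awC_awt (n : int) :
  (a * (1 - p ^ n) * (1 - b * c * p ^ (n - 1)) *
     (1 - b * d * p ^ (n - 1)) * (1 + c * d * p ^ (n - 1))) /
    ((1 - a * b * c * d * p ^ (2 * n - 2)) *
     (1 - a * b * c * d * p ^ (2 * n - 1))) = awC r X1 X2 X3 W (awt r X1 X2 n).
Proof.
rewrite /awC /awt -/q -/p pz2B1 pz2B2 pz_pred.
move: (p ^ n) => P; rewrite /a /b /c /d /q.
congr (_ * _ * _ * _ * _ / (_ * _)); field;
  by rewrite ?r_neq0 ?X1_neq0 ?X2_neq0 ?X3_neq0 ?W_neq0.
Qed.
End AskeyWilsonParameters.

Lemma sign_expr (R : pzRingType) (n : nat) : (-1 : R) ^+ n = 1 \/ (-1 : R) ^+ n = -1.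
Proof. by rewrite -(signr_odd R); case: (odd n); [right | left]. Qed.

Section SignedPowers.
Variables (R : realType) (q : R).
Hypotheses (q_gt0 : 0 < q) (q_lt1 : q < 1).

Lemma invr_sign (eps : R) : eps = 1 \/ eps = -1 -> eps^-1 = eps.
Proof. by case=> ->; rewrite ?invrN invr1. Qed.

(** A sign is its own inverse, so it can be moved inside both powers. *)
Lemma qnum_sign (eps m : R) : eps = 1 \/ eps = -1 ->
  - eps * qnum q m = (- eps * q `^ m - (- eps * q `^ m)^-1) / (q - q^-1).
Proof.
by move=> /invr_sign he; rewrite /qnum powRN invfM invrN he; ring.
Qed.

Lemma powR_bnd (m : R) : 0 < m -> 0 < q `^ m < 1.
Proof.
move=> m0; rewrite powR_gt0 //=.
have : q `^ m < 1 `^ m by apply: gt0_ltr_powR; rewrite ?nnegrE // ltW.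
by rewrite powR1.
Qed.

Lemma norm_sign_powR (eps m : R) : eps = 1 \/ eps = -1 -> 0 < m ->
  0 < `|- eps * q `^ m| < 1.
Proof.
move=> he m0; suff -> : `|- eps * q `^ m| = q `^ m by apply: powR_bnd.
rewrite normrM normrN [`|q `^ m|]gtr0_norm ?powR_gt0 //.
by case: he => ->; rewrite ?normrN normr1 mul1r.
Qed.
End SignedPowers.

(* The ground field F of the representation space is any field containing the
   reals through f, e.g. f = id for F = R, or the embedding of R into R[i].
   The default value 0 of e`_i and the convention U 0 = U N.+1 = 0 make the
   terms out of range in the action of I1 vanish. *)
Theorem mainTheorem2 (R : realType) (q : R) (hq0 : 0 < q) (hq1 : q < 1)
    (eps1 eps2 eps3 : R)
    (heps1 : eps1 = 1 \/ eps1 = -1)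
    (heps2 : eps2 = 1 \/ eps2 = -1)
    (heps3 : eps3 = 1 \/ eps3 = -1)
    (mu1 mu2 mu3 : R) (hmu1 : 0 < mu1) (hmu2 : 0 < mu2) (hmu3 : 0 < mu3)
    (N : nat) :
  let p := - q in
  let epsN := (-1) ^+ N * eps1 * eps2 * eps3 in
  let muN := N%:R + mu1 + mu2 + mu3 + 1 in
  let tau1 := - eps1 * qnum q mu1 in
  let tau2 := - eps2 * qnum q mu2 in
  let tau3 := - eps3 * qnum q mu3 in
  let tau := - epsN * qnum q muN in
  let s := q `^ (1 / 2) + q `^ (- (1 / 2)) in
  let iota1 := s * (tau * tau1 + tau2 * tau3) in
  let iota2 := s * (tau * tau2 + tau3 * tau1) in
  let iota3 := s * (tau * tau3 + tau1 * tau2) in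
  let a := eps2 * eps3 * q `^ (mu2 + mu3 + 1 / 2) in
  let b := - eps1 * epsN * q `^ (mu1 - muN + 1 / 2) in
  let c := - eps1 * epsN * q `^ (mu1 + muN + 1 / 2) in
  let d := eps2 * eps3 * q `^ (mu2 - mu3 + 1 / 2) in
  let A (n : int) :=
    - (((1 + a * b * p ^ n) * (1 - a * c * p ^ n) * (1 - a * d * p ^ n) *
        (1 - a * b * c * d * p ^ (n - 1))) /
       (a * (1 - a * b * c * d * p ^ (2 * n - 1)) *
        (1 - a * b * c * d * p ^ (2 * n)))) in
  let C (n : int) :=
    (a * (1 - p ^ n) * (1 - b * c * p ^ (n - 1)) *
     (1 - b * d * p ^ (n - 1)) * (1 + c * d * p ^ (n - 1))) /
    ((1 - a * b * c * d * p ^ (2 * n - 2)) *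
     (1 - a * b * c * d * p ^ (2 * n - 1))) in
  let lambda (n : nat) :=
    (-1) ^+ n * eps1 * eps2 * qnum q (n%:R + mu1 + mu2 + 1 / 2) in
  let U (n : nat) :=
    if (n == 0%N) || (n == N.+1) then 0
    else Num.sqrt (A (n%:Z - 1) * C n%:Z) / (q - q^-1) in
  let V (n : nat) := (a - a^-1 - A n%:Z - C n%:Z) / (q - q^-1) in
  forall (F : fieldType) (f : {rmorphism R -> F})
    (E : vectType F) (e : N.+1.-tuple E) (he : basis_of fullv e)
    (I1 I3 : 'End(E))
    (hI3 : forall n : nat, (n <= N)%N -> I3 e`_n = f (lambda n) *: e`_n)
    (hI1 : forall n : nat, (n <= N)%N ->
       I1 e`_n = f (U n.+1) *: e`_n.+1 + f (V n) *: e`_n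
                 + f (U n) *: e`_n.-1),
  let I2 : 'End(E) :=
    f (q `^ (1 / 2)) *: (I3 \o I1)%VF + f (q `^ (- (1 / 2))) *: (I1 \o I3)%VF
    - f iota2 *: \1%VF in
  let Cas : 'End(E) :=
    f (q `^ (- (1 / 2)) - q `^ (3 / 2)) *: (I1 \o I2 \o I3)%VF
    + f q *: (I1 \o I1)%VF + f q^-1 *: (I2 \o I2)%VF + f q *: (I3 \o I3)%VF
    - f ((1 - q) * iota1) *: I1 - f ((1 - q^-1) * iota2) *: I2
    - f ((1 - q) * iota3) *: I3 in
  [/\ (I1 \o I1 \o I3)%VF + f (q + q^-1) *: (I1 \o I3 \o I1)%VF
        + (I3 \o I1 \o I1)%VF
      = I3 + f (s * iota2) *: I1 + f iota3 *: \1%VF,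
      (I3 \o I3 \o I1)%VF + f (q + q^-1) *: (I3 \o I1 \o I3)%VF
        + (I1 \o I3 \o I3)%VF
      = I1 + f (s * iota2) *: I3 + f iota1 *: \1%VF,
      Cas = f (- (q - q^-1) ^+ 2 * tau1 * tau2 * tau3 * tau
               + tau1 ^+ 2 + tau2 ^+ 2 + tau3 ^+ 2 + tau ^+ 2
               - q / (1 + q) ^+ 2) *: \1%VF,
      (forall n : nat, (1 <= n <= N)%N -> U n != 0)
    & irreducible_pair I1 I3].
Proof.
move=> p epsN muN tau1 tau2 tau3 tau s iota1 iota2 iota3 a b c d A C lambda U V.
move=> F f E e he I1 I3 hI3 hI1 I2 Cas.
have q_neq0 : q != 0 by rewrite gt_eqF.
have qD x y : q `^ (x + y) = q `^ x * q `^ y by rewrite powRD // q_neq0 implybT.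
pose r := q `^ (1 / 2).
have r_bnd : 0 < r < 1 by apply: powR_bnd => //; lra.
have [r_gt0 r_lt1] := andP r_bnd.
have r_neq0 : r != 0 by rewrite gt_eqF.
have rq : r ^+ 2 = q.
  by rewrite expr2 -qD (_ : 1 / 2 + 1 / 2 = 1) ?powRr1 ?ltW //; field.
have rV : q `^ (- (1 / 2)) = r^-1 by rewrite powRN.
have r3 : q `^ (3 / 2) = r ^+ 3.
  by rewrite (_ : 3 / 2 = 1 / 2 + (1 / 2 + 1 / 2)) ?qD // -?/r; field.
have hepsN : epsN = 1 \/ epsN = -1.
  rewrite /epsN; case: (sign_expr R N) heps1 heps2 heps3 => -> [] -> [] -> [] ->;
  rewrite ?mulrN ?mulr1 ?opprK; by [left | right].
pose X1 := - eps1 * q `^ mu1; pose X2 := - eps2 * q `^ mu2.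
pose X3 := - eps3 * q `^ mu3; pose W := - epsN * q `^ muN.
have bX1 : 0 < `|X1| < 1 by apply: norm_sign_powR.
have bX2 : 0 < `|X2| < 1 by apply: norm_sign_powR.
have bX3 : 0 < `|X3| < 1 by apply: norm_sign_powR.
have neq0 (x : R) : 0 < `|x| < 1 -> x != 0 by rewrite normr_gt0 => /andP[].
have X1_neq0 := neq0 _ bX1; have X2_neq0 := neq0 _ bX2; have X3_neq0 := neq0 _ bX3.
(* The definitions of [epsN] and [muN] amount to this single equation, on which the truncation at
   [N + 1] rests. *)
have WE : W = - ((- r ^+ 2) ^+ N.+1 * X1 * X2 * X3).
  rewrite rq /W /epsN /muN /X1 /X2 /X3 !qD powRr1 ?(ltW hq0) // powR_mulrn ?(ltW hq0) //.
  by rewrite (exprNn q) !exprS; ring.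
have W_neq0 : W != 0.
  rewrite WE oppr_eq0 (mulf_neq0 (mulf_neq0 (mulf_neq0 _ X1_neq0) X2_neq0) X3_neq0) //.
  by rewrite expf_neq0 // oppr_eq0 expf_neq0.
have VX3 : X3^-1 = - eps3 * (q `^ mu3)^-1 by rewrite invfM invrN (invr_sign heps3).
have VW : W^-1 = - epsN * (q `^ muN)^-1 by rewrite invfM invrN (invr_sign hepsN).
have aE : a = r * X2 * X3 by rewrite /a !qD -/r /X2 /X3; ring.
have bE : b = - (r * X1 / W) by rewrite /b (qD _ (1 / 2)) (qD mu1) powRN -/r VW /X1; ring.
have cE : c = - (r * X1 * W) by rewrite /c (qD _ (1 / 2)) (qD mu1) -/r /X1 /W; ring.
have dE : d = r * X2 / X3 by rewrite /d !qD powRN -/r VX3 /X2; ring.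
have tau1E : tau1 = awtau r X1 by rewrite /awtau rq /tau1 qnum_sign.
have tau2E : tau2 = awtau r X2 by rewrite /awtau rq /tau2 qnum_sign.
have tau3E : tau3 = awtau r X3 by rewrite /awtau rq /tau3 qnum_sign.
have tauE : tau = awtau r W by rewrite /awtau rq /tau qnum_sign.
have AE n : A n = awA r X1 X2 X3 W (awt r X1 X2 n).
  by rewrite -awA_awt // rq -aE -bE -cE -dE.
have CE n : C n = awC r X1 X2 X3 W (awt r X1 X2 n).
  by rewrite -awC_awt // rq -aE -bE -cE -dE.
have t_lambda n : lambda n = awlam r (awt r X1 X2 n%:Z).
  rewrite /lambda /qnum powRN !qD powR_mulrn ?(ltW hq0) // -/r /awlam rq.
  rewrite mulrA; congr (_ / _).
  have -> : awt r X1 X2 n = (-1) ^+ n * eps1 * eps2 * (q ^+ n * q `^ mu1 * q `^ mu2 * r).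
    by rewrite /awt rq -exprnP (exprNn q) /X1 /X2; ring.
  by rewrite !invfM (invr_sign (sign_expr _ n)) (invr_sign heps1) (invr_sign heps2); ring.
have VE n : V n = awV r tau1 tau2 tau3 tau (awt r X1 X2 n%:Z).
  rewrite /V AE CE aE tau1E tau2E tau3E tauE WE.
  by rewrite awV_t // rq.
have AC_gt0 n : (1 <= n <= N)%N -> 0 < A (n%:Z - 1) * C n%:Z.
  by move=> nN; rewrite AE CE WE awAC_t_gt0.
have U0 : U 0 = 0 by [].
have UN : U N.+1 = 0 by rewrite /U eqxx orbT.
have Ulocal n : (1 <= n <= N)%N -> U n = Num.sqrt (A (n%:Z - 1) * C n%:Z) / (q - q^-1).
  by case/andP => n0 nN; rewrite /U gtn_eqF // ltn_eqF.
have k_neq0 : q - q^-1 != 0.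
  by rewrite subr_eq0 lt_eqF // (lt_trans hq1) // invf_gt1.
have U_sq n : (1 <= n <= N)%N ->
    U n ^+ 2 = awU2 r tau1 tau2 tau3 tau (awt r X1 X2 n%:Z).
  move=> nN; rewrite Ulocal // expr_div_n sqr_sqrtr ?ltW ?AC_gt0 //.
  by rewrite AE CE tau1E tau2E tau3E tauE WE awU2_t // rq.
have U_neq0 n : (1 <= n <= N)%N -> U n != 0.
  move=> nN; rewrite Ulocal // mulf_neq0 ?invr_eq0 //.
  by rewrite gt_eqF // sqrtr_gt0 AC_gt0.
have hI3' n : (n <= N)%N -> I3 e`_n = f (awlam r (awt r X1 X2 n)) *: e`_n.
  by move=> nN; rewrite hI3 // t_lambda.
have hI1' n : (n <= N)%N -> I1 e`_n = f (U n.+1) *: e`_n.+1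
    + f (awV r tau1 tau2 tau3 tau (awt r X1 X2 n)) *: e`_n + f (U n) *: e`_n.-1.
  by move=> nN; rewrite hI1 // VE.
have sE : s = r + r^-1 by rewrite /s -/r rV.
split=> //.
- rewrite /iota2 /iota3 sE tau1E tau2E tau3E tauE WE -rq.
  rewrite tau1E tau2E tau3E tauE WE in U_sq hI1'.
  exact (aw_rel1 r_gt0 r_lt1 bX1 bX2 bX3 he U0 UN U_sq hI3' hI1').
- rewrite /iota1 /iota2 sE tau1E tau2E tau3E tauE WE -rq.
  rewrite tau1E tau2E tau3E tauE WE in hI1'.
  exact (aw_rel2 r_gt0 r_lt1 bX1 bX2 he U0 UN hI3' hI1').
- rewrite /Cas /I2 /iota1 /iota2 /iota3 sE rV r3 -/r -rq tau1E tau2E tau3E tauE WE.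
  rewrite tau1E tau2E tau3E tauE WE in U_sq hI1'.
  exact (aw_casimir r_gt0 r_lt1 bX1 bX2 bX3 he U0 UN U_sq hI3' hI1').
(* A field morphism is injective, so distinct eigenvalues and nonzero [U n] stay so under [f]. *)
apply: (tridiagonal_irreducible (u := f \o U) (w := f \o V) (l := f \o lambda) he hI3 hI1).
  move=> i j _ _ /fmorph_inj; rewrite !t_lambda => lij.
  exact (awlam_t_inj r_gt0 r_lt1 bX1 bX2 lij).
by move=> n nN /=; rewrite fmorph_eq0 U_neq0.
Qed.
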